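(* There exists a set $A \subset \mathbb{R}^2$ of Lebesgue measure zero such that for each $x \in \mathbb{R}^2$, there is a circle $C$ such that $x\in C$ and $C\setminus A$ has at most one point.
   Context: A circle is a set $\{u\in\mathbb{R}^2:|u-z|=s\}$ with $z\in\mathbb{R}^2$ and radius $s>0$. *)

(* Defs.v *)
From HB Require Import structures.
From mathcomp Require Import all_boot all_order all_algebra.
From mathcomp Require Import all_classical all_reals all_analysis.
Set Implicit Arguments.
Unset Strict Implicit.
Unset Printing Implicit Defensive.
Import Order.TTheory GRing.Theory Num.Theory.
Import numFieldNormedType.Exports.

Local Open Scope classical_set_scope.
Local Open Scope ring_scope.

(* The library's norm on [R * R] is the max norm, hence an explicit
   Euclidean norm. *)
Definition enorm (R : realType) (u : R * R) : R :=
  Num.sqrt (u.1 ^+ 2 + u.2 ^+ 2).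

Definition circle (R : realType) (z : R * R) (s : R) : set (R * R) :=
  [set u | enorm (u - z) = s].

Definition is_circle (R : realType) (C : set (R * R)) : Prop :=
  exists (z : R * R) (s : R), 0 < s /\ C = circle z s.

(* [measurableTypeR R] is [R] with its Borel sigma-algebra. *)
Definition lebesgue_measure2 (R : realType) :
    set (measurableTypeR R * measurableTypeR R) -> \bar R :=
  ((@lebesgue_measure R) \x (@lebesgue_measure R))%E.

(* Sets of Lebesgue measure zero need not be Borel: [negligible] asks for a
   Borel superset of measure zero. *)
Definition lebesgue_null (R : realType) (A : set (R * R)) : Prop :=
  (@lebesgue_measure2 R).-negligible
    (A : set (measurableTypeR R * measurableTypeR R)).

(* Main.v *)
Require Import Defs.
From mathcomp Require Import all_boot all_order all_algebra.
From mathcomp Require Import all_classical all_reals all_analysis.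
From mathcomp Require Import ring lra.
Set Implicit Arguments.
Unset Strict Implicit.
Import Order.TTheory GRing.Theory Num.Theory.
Local Open Scope classical_set_scope.
Local Open Scope ring_scope.

(** The plane is tiled by unit translates, so it suffices to handle the points
    [x] of the rectangle [0,1] x [1,2].  Inversion maps this rectangle into
    [0,1] x [1/5,1] and turns a line missing the origin into a circle through the
    origin.  It is therefore enough to attach to every point [p] of the latter
    rectangle a line through [p], of slope [m p] close to -1 (so that it misses the
    origin), such that all these lines, each deprived of its own point [p], have a
    null union (lemma [nikodym]): a Nikodym set for lines.  The inverted set together
    with the centres of inversion is then the desired null set, and a circle can
    leave it only at the point it was attached to.

    The slope function [m] is subject to no regularity condition, so it can be found
    by a category argument in the space of bounded functions with the supremum
    distance ([baire_function]).  The union to be made null is cut into countably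
    many pieces: the points [p] with abscissa in [a, b], and the parts of their lines
    above an interval [al, be[ disjoint from [a, b], with rational bounds.
    What has to be shown is that each [m] can be perturbed slightly so that one
    piece has small content, stably under further small perturbations
    ([small_content_dense]).  Content, defined by finite covers by squares, is used
    because it is visibly stable and behaves well under Lipschitz maps.

    For this density, the lines are first rotated a little around their points so
    that above [al] they pass through finitely many heights; grouping them by
    approximate slope puts them into finitely many sectors with vertices above [al].
    Together, [N] sectors of half-angle [r] cover only an area of order [N r rho^2]
    above an interval of length [rho] starting at the vertices ([fan_content]).  At
    the end of that interval each sector is rounded to many thinner ones with
    vertices there ([fan_refine]); the rounding can be made as fine as desired while the
    total angle [N r] grows only by a factor [1 + rho / d], where [d] is the
    distance to the attached points.  Crossing [al, be[ in [k] steps of length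
    [rho = (be - al) / k] ([fan_march]) thus costs an area of order
    [k rho^2 exp ((be - al) / d)], which tends to 0 as [k] grows. *)

(** * Content *)

Definition in_square (R : realType) (q : R * R * R) (u : R * R) : Prop :=
  `|u.1 - q.1.1| <= q.2 /\ `|u.2 - q.1.2| <= q.2.

(** An upper bound for the outer Jordan content of [E]; squares are given by their
    centre and half-side, so the area covered is at most [4 * c]. *)
Definition content_le (R : realType) (E : set (R * R)) (c : R) : Prop :=
  exists Q : seq (R * R * R),
    \sum_(q <- Q) q.2 ^+ 2 <= c /\
    forall u, E u -> exists2 q, q \in Q & in_square q u.

Lemma content_leS (R : realType) (E E' : set (R * R)) (c c' : R) :
  E `<=` E' -> c' <= c -> content_le E' c' -> content_le E c.
Proof.
move=> EE' cc' [Q [Qc cov]]; exists Q; split; first exact: le_trans cc'.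
by move=> u /EE'/cov.
Qed.

Lemma content_leU (R : realType) (E E' : set (R * R)) (c c' : R) :
  content_le E c -> content_le E' c' -> content_le (E `|` E') (c + c').
Proof.
move=> [Q [Qc cov]] [Q' [Qc' cov']]; exists (Q ++ Q'); split.
  by rewrite big_cat lerD.
by move=> u [/cov|/cov'] [q qQ qu]; exists q => //; rewrite mem_cat qQ ?orbT.
Qed.

Lemma content_le_cover (R : realType) (E : set (R * R)) (P : seq (R * R)) (r : R) :
  (forall u, E u -> exists2 p, p \in P & in_square (p, r) u) ->
  content_le E ((size P)%:R * r ^+ 2).
Proof.
move=> cov; exists [seq (p, r) | p <- P]; split.
  by rewrite big_map /= big_const_seq count_predT iter_addr_0 mulr_natl.
by move=> u /cov[p pP pu]; exists (p, r) => //; exact: map_f.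
Qed.

Lemma content_le_set1 (R : realType) (z : R * R) : content_le [set z] 0.
Proof.
have -> : 0 = (size [:: z])%:R * (0 : R) ^+ 2 by rewrite expr0n mulr0.
apply: content_le_cover => _ ->; exists z; first exact: mem_head.
by split; rewrite subrr normr0.
Qed.

Lemma content_le_lipschitz (R : realType) (E : set (R * R)) (f : R * R -> R * R)
    (K c : R) : 0 <= K ->
  (forall u w r, E u -> E w -> `|u.1 - w.1| <= r -> `|u.2 - w.2| <= r ->
     in_square (f w, K * r) (f u)) ->
  content_le E c -> content_le (f @` E) (4 * K ^+ 2 * c).
Proof.
move=> K0 fK [Q [Qc cov]].
(* A square that meets [E] is replaced by a square around the image of a
   chosen point of [E] in it, at most twice as wide. *)
have /choice[g gP] (q : R * R * R) :
    exists w, (exists2 u, E u & in_square q u) -> E w /\ in_square q w.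
  have [[u Eu qu]|no] := pselect (exists2 u, E u & in_square q u).
    by exists u.
  by exists (0, 0) => /no.
exists [seq (f (g q), K * (2 * q.2)) | q <- Q]; split.
  rewrite big_map /=.
  have -> : \sum_(q <- Q) (K * (2 * q.2)) ^+ 2
      = 4 * K ^+ 2 * \sum_(q <- Q) q.2 ^+ 2.
    by rewrite mulr_sumr; apply: eq_bigr => q _; ring.
  by rewrite ler_wpM2l // mulr_ge0 ?sqr_ge0.
move=> _ [u Eu <-]; have [q qQ qu] := cov u Eu.
exists (f (g q), K * (2 * q.2)); first exact: (map_f (fun q => (f (g q), _))).
have [Ew [qw1 qw2]] := gP q (ex_intro2 _ _ u Eu qu).
have [qu1 qu2] := qu.
move: qu1 qu2 qw1 qw2; rewrite !ler_norml => qu1 qu2 qw1 qw2.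
by apply: fK => //; rewrite ler_norml; lra.
Qed.

Lemma content0_null (R : realType) (E : set (R * R)) :
  (forall c, 0 < c -> content_le E c) -> lebesgue_null E.
Proof.
move=> E0.
pose T : measurableType _ := (measurableTypeR R * measurableTypeR R)%type.
pose mu : {measure set T -> \bar R} :=
  (@lebesgue_measure R \x @lebesgue_measure R)%E.
pose sq (q : R * R * R) : set T :=
  `[q.1.1 - q.2, q.1.1 + q.2]%classic `*` `[q.1.2 - q.2, q.1.2 + q.2]%classic.
have msq q : measurable (sq q) by apply: measurableX; exact: measurable_itv.
have sqE q u : in_square q u -> sq q u.
  by move=> [h1 h2]; split => /=; rewrite in_itv /=; move: h1 h2;
     rewrite !ler_norml; lra.
have musq q : (mu (sq q) <= (4 * q.2 ^+ 2)%:E)%E.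
  have -> : mu (sq q) = (lebesgue_measure `[(q.1.1 - q.2)%R, (q.1.1 + q.2)%R]
      * lebesgue_measure `[(q.1.2 - q.2)%R, (q.1.2 + q.2)%R])%E.
    by apply: product_measure1E; exact: measurable_itv.
  rewrite !lebesgue_measure_itv /= !lte_fin.
  have [q0|q0] := leP q.2 0.
    rewrite !ifF ?mule0; first by rewrite lee_fin mulr_ge0 // sqr_ge0.
    - by apply/negbTE; rewrite -leNgt; lra.
    - by apply/negbTE; rewrite -leNgt; lra.
  have lt_q (a : R) : a - q.2 < a + q.2 by lra.
  rewrite !lt_q.
  rewrite lee_fin; nra.
have /choice[Q Qh] (n : nat) : exists Q : seq (R * R * R),
    \sum_(q <- Q) q.2 ^+ 2 <= n.+1%:R^-1 /\
    forall u, E u -> exists2 q, q \in Q & in_square q u.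
  by apply: E0; rewrite invr_gt0.
pose U n : set T := \big[setU/set0]_(q <- Q n) sq q.
have mU n : measurable (U n) by exact: bigsetU_measurable.
have muU n : (mu (U n) <= (4 * n.+1%:R^-1)%:E)%E.
  have [Qn _] := Qh n.
  apply: (@le_trans _ _ (\sum_(q <- Q n) (4 * q.2 ^+ 2)%:E)%E); last first.
    by rewrite sumEFin lee_fin -mulr_sumr ler_wpM2l.
  rewrite /U; elim: (Q n) => [|q s IH]; first by rewrite !big_nil measure0.
  rewrite !big_cons; apply: le_trans (leeD (musq q) IH).
  apply: measureU2 => //; exact: bigsetU_measurable.
exists (\bigcap_n U n : set T); split.
- exact: bigcapT_measurable.
- change (mu (\bigcap_n U n) = 0%E); apply/eqP; rewrite eq_le measure_ge0 andbT.
  apply/lee_addgt0Pr => e e0; rewrite add0e.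
  pose n := Num.truncn (4 / e).
  have ne : 4 / e < n.+1%:R.
    by have /andP[] := truncn_itv (ltW (divr_gt0 (ltr0n _ 4) e0)).
  apply: le_trans (le_trans (muU n) _).
    apply: le_measure; rewrite ?inE //; first exact: bigcapT_measurable.
    exact: bigcap_inf.
  rewrite lee_fin ler_pdivrMr // mulrC -ler_pdivrMr // ltW //.
- move=> u Eu n _; have [_ cov] := Qh n.
  have [q qQ qu] := cov u Eu.
  rewrite /U -bigcup_seq; exists q => //; exact: sqE.
Qed.

Lemma null_bigcup (R : realType) (I : countType) (A : I -> set (R * R)) :
  (forall i, lebesgue_null (A i)) -> lebesgue_null (\bigcup_i A i).
Proof.
move=> A0; pose B k := if unpickle k is Some i then A i else set0.
have B0 k : lebesgue_null (B k).
  by rewrite /B; case: (unpickle k) => [i|]; [exact: A0 | exact: negligible_set0].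
apply: negligibleS (negligible_bigcup B0).
by move=> u [i _ Ai]; exists (pickle i) => //; rewrite /B pickleK.
Qed.

(** * Fans of lines *)

Definition line (R : realType) (p : R * R) (a s : R) : R := p.2 + a * (s - p.1).

(** The parts above [al, be[ of the lines through the points [p] of [S] with slope
    [m p]. *)
Definition segments (R : realType) (S : set (R * R)) (al be : R)
    (m : R * R -> R) : set (R * R) :=
  [set u | exists2 p, S p & al <= u.1 < be /\ u.2 = line p (m p) u.1].

(** A fan at abscissa [v] is a finite list [F] of vertices, each given as a height
    above [v] together with a direction; the lines through a vertex stay in the
    angular sector of half-width [r] around its direction. *)
Definition in_fan (R : realType) (S : set (R * R)) (v : R) (F : seq (R * R))
    (r : R) (m : R * R -> R) : Prop :=
  forall p, S p ->
    exists2 f, f \in F & line p (m p) v = f.1 /\ `|m p - f.2| <= r.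

Lemma grid (R : realType) (L x : R) (n : nat) : (0 < n)%N -> 0 < L -> `|x| <= L ->
  exists2 j : nat, (j < n)%N & `|x - (2 * j%:R + 1 - n%:R) * (L / n%:R)| <= L / n%:R.
Proof.
move=> n0 Lpos xL.
have n0' : 0 < n%:R :> R by rewrite ltr0n.
pose h := L / n%:R.
have h0 : 0 < h by rewrite divr_gt0.
have Lh : L = n%:R * h by rewrite /h mulrC divfK // gt_eqF.
move: xL; rewrite ler_norml => /andP[xl xr].
have y0 : 0 <= (x + L) / (2 * h) by apply: divr_ge0; lra.
have hh : 0 < 2 * h by lra.
have /andP[j1 j2] := truncn_itv y0; set j := Num.truncn _ in j1 j2.
move: j1 j2; rewrite -natr1 ler_pdivlMr ?ltr_pdivrMr // => j1 j2.
have [jn|nj] := ltnP j n.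
  exists j => //; rewrite -/h ler_norml; apply/andP; split; nra.
have nj' : n%:R <= j%:R :> R by rewrite ler_nat.
exists n.-1; first by rewrite prednK.
have -> : n.-1%:R = n%:R - 1 :> R by rewrite -subn1 natrB.
rewrite -/h ler_norml; apply/andP; split; nra.
Qed.

(** Above an interval of length [rho] starting at the vertex, a sector is a thin
    triangle, of height comparable to [r * rho]; covering it by about [1 / r] squares
    of that size costs an area of order [r * rho ^+ 2].  The lines of [m'] stay within
    [r * rho] of those of [m] when [eta] is at most [r * rho / D], so the same squares,
    slightly enlarged, still cover. *)
Lemma fan_content (R : realType) (S : set (R * R)) (v rho r D : R)
    (F : seq (R * R)) (m : R * R -> R) :
  0 < r -> r <= 1 -> 0 < rho -> 0 < D ->
  (forall p, S p -> `|m p| <= 2) ->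
  (forall p s, S p -> v <= s <= v + rho -> `|s - p.1| <= D) ->
  in_fan S v F r m ->
  exists2 eta, 0 < eta &
    forall m', (forall p, S p -> `|m' p - m p| <= eta) ->
      content_le (segments S v (v + rho) m') (32 * ((size F)%:R * r) * rho ^+ 2).
Proof.
move=> r0 r1 rho0 D0 mb dist fan.
set q := r * rho; have q0 : 0 < q by rewrite mulr_gt0.
exists (q / D); first by rewrite divr_gt0.
move=> m' m'm.
pose N := (Num.truncn r^-1).+1.
have ri : 0 <= r^-1 by rewrite invr_ge0 ltW.
have /andP[N1 N2] := truncn_itv ri; rewrite -/N in N2.
have Nr : N%:R * r <= 2.
  rewrite /N -natr1 mulrDl mul1r.
  have : (Num.truncn r^-1)%:R * r <= r^-1 * r by rewrite ler_wpM2r // ltW.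
  rewrite mulVf ?gt_eqF //; lra.
pose P := [seq (v + j%:R * q, f.1 + f.2 * (j%:R * q)) | f <- F, j <- iota 0 N].
apply: (@content_leS _ _ (segments S v (v + rho) m') _
  ((size P)%:R * (4 * q) ^+ 2)) => //.
  rewrite size_allpairs size_iota natrM.
  have -> : (size F)%:R * N%:R * (4 * q) ^+ 2
     = (16 * ((size F)%:R * r) * rho ^+ 2) * (N%:R * r) by rewrite /q; ring.
  have -> : 32 * ((size F)%:R * r) * rho ^+ 2
     = (16 * ((size F)%:R * r) * rho ^+ 2) * 2 by ring.
  by rewrite ler_wpM2l // !mulr_ge0 ?ler0n ?sqr_ge0 // ltW.
apply: content_le_cover => -[s y] [p Sp /= [/andP[vs sv] ->]].
have [f fF [ph sl]] := fan p Sp.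
have t0 : 0 <= (s - v) / q by rewrite divr_ge0 ?subr_ge0 // ltW.
have /andP[j1 j2] := truncn_itv t0; set j := Num.truncn _ in j1 j2.
move: j1 j2; rewrite -natr1 ler_pdivlMr ?ltr_pdivrMr // => j1 j2.
have jN : (j < N)%N.
  rewrite -(ltr_nat R); apply: le_lt_trans N2.
  rewrite -(ler_pM2r q0); apply: (le_trans j1).
  by rewrite /q mulrA mulVf ?gt_eqF // mul1r; lra.
exists (v + j%:R * q, f.1 + f.2 * (j%:R * q)).
  by apply/allpairsP; exists (f, j); rewrite mem_iota.
split => /=; first by rewrite ler_norml; lra.
have err : `|(m' p - m p) * (s - p.1)| <= q.
  rewrite normrM; apply: le_trans (ler_pM _ _ (m'm p Sp) (dist p s Sp _)) _ => //.
    lra.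
  by rewrite divfK // gt_eqF.
have slope : `|(m p - f.2) * (j%:R * q)| <= q.
  rewrite normrM; apply: (ler_pM _ _ sl) => //.
  by rewrite ger0_norm ?mulr_ge0 ?ler0n // ?ltW //; lra.
have cell : `|m p * (s - v - j%:R * q)| <= 2 * q.
  rewrite normrM; apply: (ler_pM _ _ (mb p Sp)) => //.
  by rewrite ler_norml; lra.
have -> : line p (m' p) s - (f.1 + f.2 * (j%:R * q))
  = (m' p - m p) * (s - p.1) + (m p - f.2) * (j%:R * q)
    + m p * (s - v - j%:R * q).
  by rewrite -ph /line; ring.
apply: le_trans (ler_normD _ _) _.
have := ler_normD ((m' p - m p) * (s - p.1)) ((m p - f.2) * (j%:R * q)).
lra.
Qed.

(** Away from the point [p] it is attached to, a line is made to pass through a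
    prescribed nearby point by a proportionally small rotation. *)
Lemma adjust_height (R : realType) (p : R * R) (a v y d e : R) :
  0 < d -> d <= `|v - p.1| -> `|y - line p a v| <= e ->
  exists2 b, line p b v = y & `|b - a| <= e / d.
Proof.
move=> d0 dv ye.
have n0 : v - p.1 != 0 by rewrite -normr_gt0; exact: lt_le_trans dv.
exists (a + (y - line p a v) / (v - p.1)).
  by rewrite /line mulrDl divfK //; ring.
rewrite addrAC subrr add0r normrM normfV.
apply: ler_pM => //.
by rewrite lef_pV2 // posrE; exact: lt_le_trans dv.
Qed.

(** At abscissa [v + rho] the lines through a vertex spread over an interval of
    length [2 * r * rho].  They are split into [n] groups by their slope, and each
    line is rotated about its point to pass where the central direction of its group
    does.  This rotation is at most [r / n * rho / d], so the groups are again
    sectors, wider than [r / n] only by the factor [1 + rho / d]; the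
    product of the number of vertices and the angle is thus almost unchanged. *)
Lemma fan_refine (R : realType) (S : set (R * R)) (v rho r d : R)
    (F : seq (R * R)) (m : R * R -> R) (n : nat) :
  0 < r -> 0 <= rho -> 0 < d -> (0 < n)%N ->
  (forall p, S p -> d <= `|v + rho - p.1|) ->
  in_fan S v F r m ->
  exists F' m', [/\ size F' = (n * size F)%N,
    in_fan S (v + rho) F' (r / n%:R * (1 + rho / d)) m' &
    forall p, `|m' p - m p| <= r / n%:R * rho / d].
Proof.
move=> r0 rho0 d0 n0 dist fan.
have rn0 : 0 <= r / n%:R by rewrite divr_ge0 // ltW.
pose g (f : R * R) (j : nat) := f.2 + (2 * j%:R + 1 - n%:R) * (r / n%:R).
pose F' := [seq (f.1 + g f j * rho, g f j) | f <- F, j <- iota 0 n].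
have /choice[m' m'P] (p : R * R) : exists b,
    `|b - m p| <= r / n%:R * rho / d /\ (S p -> exists2 f, f \in F' &
       line p b (v + rho) = f.1 /\ `|b - f.2| <= r / n%:R * (1 + rho / d)).
  have [Sp|nSp] := pselect (S p); last first.
    by exists (m p); split => //; rewrite subrr normr0 divr_ge0 ?mulr_ge0 // ltW.
  have [f fF [ph sl]] := fan p Sp.
  have [j jn jP] := grid n0 r0 sl.
  have gP : `|m p - g f j| <= r / n%:R by rewrite /g opprD addrA.
  have hP : `|f.1 + g f j * rho - line p (m p) (v + rho)| <= r / n%:R * rho.
    have -> : f.1 + g f j * rho - line p (m p) (v + rho) = (g f j - m p) * rho.
      by rewrite -ph /line; ring.
    by rewrite normrM (ger0_norm rho0) ler_wpM2r // distrC.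
  have [b bh bm] := adjust_height d0 (dist p Sp) hP.
  exists b; split => // _; exists (f.1 + g f j * rho, g f j).
    by apply/allpairsP; exists (f, j); rewrite mem_iota.
  split=> //=; have -> : b - g f j = (b - m p) + (m p - g f j) by ring.
  apply: le_trans (ler_normD _ _) _.
  by rewrite mulrDr mulr1 mulrA; lra.
exists F', m'; split.
- by rewrite size_allpairs size_iota mulnC.
- by move=> p Sp; have [_ /(_ Sp)] := m'P p.
- by move=> p; have [] := m'P p.
Qed.

(** Iteration of [fan_content] and [fan_refine].  The refinement at each step is
    taken so fine that the later rotations altogether stay within the tolerances
    for which the earlier intervals are covered. *)
Lemma fan_march (R : realType) (S : set (R * R)) (rho d D : R) (k : nat) :
  0 < rho -> 0 < d -> 0 < D ->
  forall (v r delta : R) (F : seq (R * R)) (m : R * R -> R),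
  0 < r -> r <= 1 -> 0 < delta ->
  (forall p, S p -> `|m p| + delta <= 2) ->
  (forall p s, S p -> v <= s <= v + k%:R * rho -> d <= `|s - p.1| <= D) ->
  in_fan S v F r m ->
  exists m' eta, [/\ 0 < eta, forall p, `|m' p - m p| <= delta &
    forall m'', (forall p, S p -> `|m'' p - m' p| <= eta) ->
      content_le (segments S v (v + k%:R * rho) m'')
        (k%:R * (32 * ((size F)%:R * r) * (1 + rho / d) ^+ k * rho ^+ 2))].
Proof.
move=> rho0 d0 D0; pose B := 1 + rho / d.
have rd0 : 0 < rho / d by rewrite divr_gt0.
have B1 : 1 <= B by rewrite /B; lra.
elim: k => [|k IH] v r delta F m r0 r1 delta0 mb dist fan.
  exists m, 1; split => [//|p|m'' _]; first by rewrite subrr normr0 ltW.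
  rewrite mul0r addr0 mul0r; exists [::]; split; first by rewrite big_nil.
  by move=> u [p _ [/andP[h1 h2] _]]; move: (le_lt_trans h1 h2); rewrite ltxx.
have kk : v + k.+1%:R * rho = (v + rho) + k%:R * rho by rewrite -natr1; ring.
have k0 : 0 <= k%:R * rho by rewrite mulr_ge0 ?ler0n // ltW.
have mb2 p : S p -> `|m p| <= 2 by move=> /mb; lra.
have [|e0 e00 He0] := fan_content r0 r1 rho0 D0 mb2 _ fan.
  by move=> p s Sp sv; have /andP[] := dist p s Sp ltac:(rewrite kk; lra).
pose e := Num.min (delta / 2) (e0 / 4).
have epos : 0 < e by rewrite lt_min !divr_gt0.
have ed : e <= delta / 2 by rewrite ge_min lexx.
have ee0 : e <= e0 / 4 by rewrite ge_min lexx orbT.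
(* Of the two lower bounds on [n], [B] keeps the new angle at most 1, and
   [rho / d / e] keeps the rotation below the tolerance [e]. *)
pose n := (Num.truncn (Num.max B (rho / d / e))).+1.
have x0 : 0 <= Num.max B (rho / d / e) by rewrite le_max; lra.
have nB : Num.max B (rho / d / e) < n%:R by have /andP[] := truncn_itv x0.
move: nB; rewrite gt_max => /andP[nB nr].
have n0 : 0 < n%:R :> R by rewrite ltr0n.
have distv p : S p -> d <= `|v + rho - p.1|.
  by move=> Sp; have /andP[] := dist p (v + rho) Sp ltac:(rewrite kk; lra).
have [F' [m1 [sF' fan' m1m]]] :=
  fan_refine r0 (ltW rho0) d0 (ltn0Sn _ : (0 < n)%N) distv fan.
have m1e p : `|m1 p - m p| <= e.
  apply: le_trans (m1m p) _.
  have -> : r / n%:R * rho / d = r * (rho / d / n%:R) by ring.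
  have ne : rho / d / n%:R <= e.
    by move: nr; rewrite ltr_pdivrMr // ler_pdivrMr //; lra.
  have : 0 <= rho / d / n%:R by rewrite divr_ge0 // ltW.
  nra.
have r'0 : 0 < r / n%:R * B by rewrite !mulr_gt0 ?invr_gt0 //; lra.
have r'1 : r / n%:R * B <= 1.
  have -> : r / n%:R * B = r * (B / n%:R) by ring.
  have Bn : B / n%:R <= 1 by rewrite ler_pdivrMr // mul1r ltW.
  have : 0 <= B / n%:R by rewrite divr_ge0 //; lra.
  nra.
have mb1 p : S p -> `|m1 p| + e <= 2.
  move=> Sp; have := mb p Sp; have := m1e p.
  have := ler_normD (m1 p - m p) (m p); rewrite subrK; lra.
have dist' p s : S p -> v + rho <= s <= v + rho + k%:R * rho ->
    d <= `|s - p.1| <= D.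
  by move=> Sp sv; apply: dist Sp _; rewrite kk; lra.
have [m' [eta [eta0 m'm1 cont]]] :=
  IH _ _ _ _ _ r'0 r'1 epos mb1 dist' fan'.
(* The tolerance [e0] is spent as follows: [e0 / 4] on this rotation, [e0 / 4] on
   the later ones, [e0 / 2] on the final perturbation. *)
exists m', (Num.min eta (e0 / 2)); split.
- by rewrite lt_min eta0 divr_gt0.
- move=> p; have := m'm1 p; have := m1e p.
  have := ler_normD (m' p - m1 p) (m1 p - m p); rewrite addrA subrK; lra.
move=> m'' m''m'.
have close p : S p -> `|m'' p - m' p| <= eta /\ `|m'' p - m p| <= e0.
  move=> Sp; have := m''m' p Sp; rewrite le_min => /andP[-> h]; split => //.
  have := m'm1 p; have := m1e p; have := ler_normD (m' p - m1 p) (m1 p - m p).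
  have := ler_normD (m'' p - m' p) (m' p - m p).
  by rewrite !addrA !subrK; lra.
have C0 := He0 m'' (fun p Sp => (close p Sp).2).
have C1 := cont m'' (fun p Sp => (close p Sp).1).
apply: content_leS (content_leU C0 C1).
  move=> [s y] [p Sp /= [/andP[vs sv] ye]].
  have [svr|vrs] := ltP s (v + rho).
    by left; exists p => //=; rewrite vs svr.
  by right; exists p => //=; rewrite vrs -kk sv.
have Bk : 1 <= B ^+ k.+1 by rewrite exprn_ege1.
have H0 : 0 <= 32 * ((size F)%:R * r) * rho ^+ 2.
  by rewrite !mulr_ge0 ?ler0n ?sqr_ge0 // ltW.
have -> : (size F')%:R * (r / n%:R * B) = (size F)%:R * r * B.
  by rewrite sF' natrM; field; rewrite gt_eqF.
have -> : k%:R * (32 * ((size F)%:R * r * B) * B ^+ k * rho ^+ 2)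
  = k%:R * (32 * ((size F)%:R * r) * rho ^+ 2 * B ^+ k.+1).
  by rewrite [B ^+ k.+1]exprS; ring.
have -> : k.+1%:R * (32 * ((size F)%:R * r) * B ^+ k.+1 * rho ^+ 2)
  = 32 * ((size F)%:R * r) * rho ^+ 2 * B ^+ k.+1
    + k%:R * (32 * ((size F)%:R * r) * rho ^+ 2 * B ^+ k.+1).
  by rewrite -[k.+1%:R]natr1; move: (B ^+ k.+1) => X; ring.
by rewrite lerD2r ler_peMr.
Qed.

(** A first fan of angle 1 with vertices on a fixed grid: since slopes are at most 2
    in absolute value, the two directions 1 and -1 suffice. *)
Lemma fan_start (R : realType) (S : set (R * R)) (v d K delta : R)
    (m : R * R -> R) :
  0 < d -> 0 < K -> 0 < delta ->
  (forall p, S p -> `|m p| + delta <= 2) ->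
  (forall p, S p -> d <= `|v - p.1| /\ `|line p (m p) v| <= K) ->
  exists F m', in_fan S v F 1 m' /\ forall p, `|m' p - m p| <= delta.
Proof.
move=> d0 K0 delta0 mb dist.
pose n := (Num.truncn (K / d / delta)).+1.
have x0 : 0 <= K / d / delta by rewrite !divr_ge0 // ltW.
have nK : K / d / delta < n%:R by have /andP[] := truncn_itv x0.
have n0 : 0 < n%:R :> R by rewrite ltr0n.
pose y (j : nat) : R := (2 * j%:R + 1 - n%:R) * (K / n%:R).
pose F := [seq (y j, a) | j <- iota 0 n, a <- [:: 1; -1 : R]].
have /choice[m' m'P] (p : R * R) : exists b, `|b - m p| <= delta /\
    (S p -> exists2 f, f \in F & line p b v = f.1 /\ `|b - f.2| <= 1).
  have [Sp|nSp] := pselect (S p); last first.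
    by exists (m p); split => //; rewrite subrr normr0 ltW.
  have [dv lK] := dist p Sp.
  have [j jn jP] := grid (ltn0Sn _ : (0 < n)%N) K0 lK.
  rewrite -/(y j) distrC in jP.
  have [b bh bm] := adjust_height d0 dv jP.
  have bd : `|b - m p| <= delta.
    apply: le_trans bm _.
    have -> : K / n%:R / d = K / d / n%:R by ring.
    by move: nK; rewrite ltr_pdivrMr // ler_pdivrMr //; lra.
  exists b; split => // _.
  have b2 : `|b| <= 2.
    have := mb p Sp; have := ler_normD (b - m p) (m p); rewrite subrK; lra.
  move: b2; rewrite ler_norml => b2.
  have [b0|b0] := leP 0 b.
    exists (y j, 1); first by apply/allpairsP; exists (j, 1); rewrite mem_iota inE eqxx.
    by split => //=; rewrite ler_norml; lra.
  exists (y j, -1).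
    by apply/allpairsP; exists (j, -1); rewrite mem_iota !inE eqxx orbT.
  by split => //=; rewrite ler_norml; lra.
exists F, m'; split => [p Sp|p]; last by have [] := m'P p.
by have [_ /(_ Sp)] := m'P p.
Qed.

(** The fan at the beginning is chosen before the number [k] of steps, hence the
    bound of [fan_march], of order [1 / k], can be made at most [eps]. *)
Lemma small_content_dense (R : realType) (S : set (R * R)) (al be d D eps delta : R)
    (m : R * R -> R) :
  al < be -> 0 < d -> 0 < D -> 0 < eps -> 0 < delta ->
  (forall p, S p -> `|m p| + delta <= 2) ->
  (forall p, S p -> `|p.2| <= 1) ->
  (forall p s, S p -> al <= s <= be -> d <= `|s - p.1| <= D) ->
  exists m' eta, [/\ 0 < eta, forall p, `|m' p - m p| <= delta &
    forall m'', (forall p, S p -> `|m'' p - m' p| <= eta) ->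
      content_le (segments S al be m'') eps].
Proof.
move=> albe d0 D0 eps0 delta0 mb p1 dist.
have dh : 0 < delta / 2 by lra.
have [|p Sp||F [m1 [fan m1m]]] := @fan_start _ S al d (1 + 2 * D) (delta / 2) m d0 _ dh.
- by lra.
- by have := mb p Sp; lra.
- move=> p Sp; have /andP[-> aD] : d <= `|al - p.1| <= D.
    by apply: dist Sp _; lra.
  split=> //; rewrite /line; apply: le_trans (ler_normD _ _) _.
  rewrite lerD ?p1 // normrM ler_pM //.
  by have := mb p Sp; lra.
have mb1 p : S p -> `|m1 p| + delta / 2 <= 2.
  move=> Sp; have := mb p Sp; have := m1m p.
  have := ler_normD (m1 p - m p) (m p); rewrite subrK; lra.
pose L := be - al; have L0 : 0 < L by rewrite subr_gt0.
(* With [rho = L / k] the bound of [fan_march] is at most [C / k]. *)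
pose C := 32 * ((size F)%:R * 1) * expR (L / d) * L ^+ 2.
have H0 : 0 <= 32 * ((size F)%:R * 1) * L ^+ 2.
  by rewrite mulr1 mulr_ge0 ?sqr_ge0 // mulr_ge0.
have C0 : 0 <= C.
  by rewrite /C mulrAC mulr_ge0 ?expR_ge0.
pose k := (Num.truncn (C / eps)).+1.
have kC : C / eps < k%:R.
  by have /andP[] := truncn_itv (divr_ge0 C0 (ltW eps0)).
have k0 : 0 < k%:R :> R by rewrite ltr0n.
pose rho := L / k%:R; have rho0 : 0 < rho by rewrite divr_gt0.
have krho : k%:R * rho = L by rewrite mulrC divfK // gt_eqF.
have be_ : be = al + k%:R * rho by rewrite krho /L addrC subrK.
have dist' p s : S p -> al <= s <= al + k%:R * rho -> d <= `|s - p.1| <= D.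
  by rewrite -be_; exact: dist.
have [m' [eta [eta0 m'm1 cont]]] :=
  fan_march rho0 d0 D0 ltr01 (lexx 1) dh mb1 dist' fan.
exists m', eta; split => // [p|m'' /cont].
  have := m'm1 p; have := m1m p.
  have := ler_normD (m' p - m1 p) (m1 p - m p); rewrite addrA subrK; lra.
rewrite -be_; apply: content_leS => //.
have Bk : (1 + rho / d) ^+ k <= expR (L / d).
  have -> : L / d = k%:R * (rho / d) by rewrite mulrA krho.
  rewrite expRM_natl; apply: lerXn2r; rewrite ?nnegrE ?expR_ge0 ?expR_ge1Dx //.
  by rewrite addr_ge0 // divr_ge0 // ltW.
have -> : k%:R * (32 * ((size F)%:R * 1) * (1 + rho / d) ^+ k * rho ^+ 2)
  = 32 * ((size F)%:R * 1) * (k%:R * rho) ^+ 2 * (1 + rho / d) ^+ k / k%:R.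
  by field; rewrite gt_eqF.
rewrite krho ler_pdivrMr //.
apply: (@le_trans _ _ C); last first.
  by move: kC; rewrite ltr_pdivrMr //; lra.
by rewrite /C (mulrAC _ (expR _)) ler_wpM2l.
Qed.

(** * A Nikodym set for lines *)

(** The balls obtained successively for the properties [P k] are nested for the
    supremum distance, so at each point [p] they cut out nested segments; the supremum
    of their left ends gives a common element, without any completeness statement for
    function spaces. *)
Lemma baire_function (R : realType) (T : Type) (P : nat -> (T -> R) -> Prop)
    (m0 : T -> R) (e0 : R) : 0 < e0 ->
  (forall k m delta, 0 < delta -> (forall p, `|m p - m0 p| + delta <= e0) ->
     exists m' eta, [/\ 0 < eta, forall p, `|m' p - m p| <= delta &
       forall m'', (forall p, `|m'' p - m' p| <= eta) -> P k m'']) ->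
  exists2 m, forall p, `|m p - m0 p| <= e0 & forall k, P k m.
Proof.
move=> e00 dense.
pose good (x : (T -> R) * R) := 0 < x.2 /\ forall p, `|x.1 p - m0 p| + x.2 <= e0.
have /choice[next nextP] (kx : nat * ((T -> R) * R)) :
    exists y : (T -> R) * R, good kx.2 ->
      [/\ good y, forall p, `|y.1 p - kx.2.1 p| + y.2 <= kx.2.2 &
        forall m, (forall p, `|m p - y.1 p| <= y.2) -> P kx.1 m].
  case: kx => k [m r] /=.
  have [[r0 mr]|ng] := pselect (good (m, r)); last by exists (m, r) => /ng.
  have r2 : 0 < r / 2 by rewrite /= in r0; lra.
  have [|m' [eta [eta0 m'm Pm']]] := dense k m (r / 2) r2.
    by move=> p; have := mr p => /=; lra.
  have er : Num.min eta (r / 2) <= r / 2 by rewrite ge_min lexx orbT.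
  exists (m', Num.min eta (r / 2)) => _ /=; split.
  - split=> /=; first by rewrite lt_min eta0.
    move=> p; have := mr p; have := m'm p => /=.
    have := ler_normD (m' p - m p) (m p - m0 p); rewrite addrA subrK; lra.
  - by move=> p; have := m'm p; lra.
  - by move=> m'' h; apply: Pm' => p; apply: le_trans (h p) _; rewrite ge_min lexx.
pose x := fix x k := if k is j.+1 then next (j, x j) else (m0, e0).
have xgood k : good (x k).
  elim: k => [|k IH]; last by have [] := nextP (k, x k) IH.
  by split=> //= p; rewrite subrr normr0 add0r.
have nest1 k p : `|(x k.+1).1 p - (x k).1 p| + (x k.+1).2 <= (x k).2.
  by have [_ /(_ p)] := nextP (k, x k) (xgood k).
have nest j k p : (x j).1 p - (x j).2 <= (x (j + k)%N).1 p - (x (j + k)%N).2 /\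
    (x (j + k)%N).1 p + (x (j + k)%N).2 <= (x j).1 p + (x j).2.
  elim: k => [|k [IH1 IH2]]; first by rewrite addn0.
  have := nest1 (j + k)%N p; rewrite addnS -lerBrDr ler_norml; lra.
have cross j k p : (x j).1 p - (x j).2 <= (x k).1 p + (x k).2.
  have [h1 _] := nest j k p; have [_ h2] := nest k j p; rewrite addnC in h2.
  have [h _] := xgood (j + k)%N; lra.
pose m p := sup [set (x k).1 p - (x k).2 | k in [set: nat]].
have mx k p : `|m p - (x k).1 p| <= (x k).2.
  have lb : (x k).1 p - (x k).2 <= m p.
    apply: sup_upper_bound; last by exists k.
    split; first by exists ((x 0%N).1 p - (x 0%N).2); exists 0%N.
    by exists ((x 0%N).1 p + (x 0%N).2) => _ [j _ <-].
  have ub : m p <= (x k).1 p + (x k).2.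
    apply: ge_sup; first by exists ((x 0%N).1 p - (x 0%N).2); exists 0%N.
    by move=> _ [j _ <-].
  by rewrite ler_norml; lra.
exists m => [p|k]; first exact: mx 0%N p.
have [_ _] := nextP (k, x k) (xgood k); apply; exact: mx k.+1.
Qed.

(** The rectangle [0,1] x [1/5,1] contains the inverse of [0,1] x [1,2]; cutting it
    vertically separates the points [p] from the segments considered. *)
Definition slab (R : realType) (a b : R) : set (R * R) :=
  [set p | [/\ 0 <= p.1 <= 1, 1 / 5 <= p.2 <= 1 & a <= p.1 <= b]].

Lemma nikodym (R : realType) :
  exists2 m : R * R -> R, forall p, `|m p + 1| <= 1 / 2 &
    forall a b al be : rat, (be < a) || (b < al) ->
    forall c, 0 < c ->
      content_le (segments (slab (ratr a) (ratr b)) (ratr al) (ratr be) m) c.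
Proof.
pose P (i : rat * rat * rat * rat * nat) (m : R * R -> R) :=
  let: (a, b, al, be, n) := i in (be < a) || (b < al) ->
    content_le (segments (slab (ratr a) (ratr b)) (ratr al) (ratr be) m) n.+1%:R^-1.
pose P' k m := if unpickle k is Some i then P i m else True.
have h0 : 0 < 1 / 2 :> R by lra.
have [|m mb Pm] := @baire_function R _ P' (fun=> -1) (1 / 2) h0; last first.
  exists m => [p|a b al be sep c c0]; first by have := mb p; rewrite opprK.
  pose n := Num.truncn c^-1.
  have ci : 0 <= c^-1 by rewrite invr_ge0 ltW.
  have nc : c^-1 < n.+1%:R by have /andP[] := truncn_itv ci.
  have := Pm (pickle (a, b, al, be, n)); rewrite /P' pickleK => /(_ sep).
  apply: content_leS => //.
  by rewrite -[c]invrK lef_pV2 ?posrE ?invr_gt0 // ltW.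
move=> k m delta delta0 md.
have mb p : `|m p| + delta <= 2.
  by have := md p; have := ler_normB (m p - -1) 1; rewrite normr1 opprK addrK; lra.
rewrite /P'; case: (unpickle k) => [[[[[a b] al] be] n]|]; last first.
  exists m, 1; split => // p; by rewrite subrr normr0 ltW.
rewrite /P; have [sep|_] := boolP ((be < a) || (b < al)); last first.
  exists m, 1; split => // p; by rewrite subrr normr0 ltW.
have [bea|albe] := leP (ratr be : R) (ratr al).
  exists m, 1; split => // [p|m'' _ _]; first by rewrite subrr normr0 ltW.
  exists [::]; split; first by rewrite big_nil.
  move=> u [p _ [/andP[h1 h2] _]].
  by move: (le_lt_trans h1 h2) bea; rewrite ltNge => /negP.
have [d d0 dP] : exists2 d : R, 0 < d & forall p s, slab (ratr a) (ratr b) p ->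
    ratr al <= s <= ratr be -> d <= `|s - p.1|.
  case/orP: sep => sep; have sepR := sep; rewrite -(ltr_rat R) in sepR.
    exists (ratr a - ratr be); first by rewrite subr_gt0.
    move=> p s [_ _ pab] sab; rewrite distrC; apply: le_trans (ler_norm _); lra.
  exists (ratr al - ratr b); first by rewrite subr_gt0.
  move=> p s [_ _ pab] sab; apply: le_trans (ler_norm _); lra.
pose D : R := `|ratr al| + `|ratr be| + 1.
have Dal : `|ratr al| + `|ratr be| <= D - 1 by rewrite /D addrK.
have D0 : 0 < D by rewrite /D ltr_wpDl ?addr_ge0.
have n0 : 0 < (n.+1%:R)^-1 :> R by rewrite invr_gt0 ltr0n.
have [| |p s Sp sal|m' [eta [eta0 m'm Pm']]] := @small_content_dense R
  (slab (ratr a) (ratr b)) (ratr al) (ratr be) d D n.+1%:R^-1 delta m albe d0 D0 n0 delta0.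
- by [].
- by move=> p [_ p1 _]; rewrite ler_norml; lra.
- rewrite (dP p s Sp sal) /=; have [p1 _ _] := Sp.
  have := ler_norm (ratr al : R); have := ler_norm (ratr be : R).
  have := ler_norm (- ratr al : R); have := ler_norm (- ratr be : R).
  have : 0 <= `|ratr al : R| by []. have : 0 <= `|ratr be : R| by [].
  by rewrite !normrN ler_norml; lra.
exists m', eta; split => // m'' h _; apply: Pm' => p _; exact: h.
Qed.

Lemma rat_between (R : realType) (x y : R) : x < y -> exists q : rat, x < ratr q < y.
Proof. by move=> /rat_in_itvoo[q]; rewrite in_itv /=; exists q. Qed.

Lemma separating_windows (R : realType) (s t : R) : s != t ->
  exists a b al be : rat, [/\ (be < a) || (b < al), (ratr a : R) <= t <= ratr b &
     (ratr al : R) <= s < ratr be].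
Proof.
have below (x : R) : x - 1 < x by lra.
have above (x : R) : x < x + 1 by lra.
rewrite neq_lt => /orP[st|ts].
  have [be /andP[be1 be2]] := rat_between st.
  have [a /andP[a1 a2]] := rat_between be2.
  have [al /andP[_ al2]] := rat_between (below s).
  have [b /andP[b1 _]] := rat_between (above t).
  exists a, b, al, be; split; [|by lra|by lra].
  by rewrite -(ltr_rat R) a1.
have [b /andP[b1 b2]] := rat_between ts.
have [al /andP[al1 al2]] := rat_between b2.
have [a /andP[_ a2]] := rat_between (below t).
have [be /andP[be1 _]] := rat_between (above s).
exists a, b, al, be; split; [|by lra|by lra].
by rewrite -!(ltr_rat R) al1 orbT.
Qed.

(** * Inversion *)

Definition sqnorm (R : realType) (u : R * R) : R := u.1 ^+ 2 + u.2 ^+ 2.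

Definition inversion (R : realType) (z u : R * R) : R * R :=
  (z.1 + u.1 / sqnorm u, z.2 + u.2 / sqnorm u).

(** Inversion multiplies the Euclidean distance of [u] and [w] by the inverse of the
    product of their norms. *)
Lemma inversion_lipschitz (R : realType) (z u w : R * R) (c r : R) :
  0 < c -> c <= sqnorm u -> c <= sqnorm w ->
  `|u.1 - w.1| <= r -> `|u.2 - w.2| <= r ->
  in_square (inversion z w, 2 / c * r) (inversion z u).
Proof.
move=> c0 cu cw h1 h2.
have r0 : 0 <= r by apply: le_trans h1.
have U0 : 0 < sqnorm u by exact: lt_le_trans cu.
have W0 : 0 < sqnorm w by exact: lt_le_trans cw.
have dist : (u.1 / sqnorm u - w.1 / sqnorm w) ^+ 2 +
    (u.2 / sqnorm u - w.2 / sqnorm w) ^+ 2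
  = ((u.1 - w.1) ^+ 2 + (u.2 - w.2) ^+ 2) / (sqnorm u * sqnorm w).
  move: U0 W0; rewrite /sqnorm => U0 W0; field.
  by rewrite !gt_eqF.
have s1 : (u.1 - w.1) ^+ 2 <= r ^+ 2 by rewrite -real_normK ?num_real // ler_sqr ?nnegrE.
have s2 : (u.2 - w.2) ^+ 2 <= r ^+ 2 by rewrite -real_normK ?num_real // ler_sqr ?nnegrE.
have K0 : 0 <= 2 / c * r by rewrite mulr_ge0 // divr_ge0 // ltW.
have bound : (u.1 / sqnorm u - w.1 / sqnorm w) ^+ 2 +
    (u.2 / sqnorm u - w.2 / sqnorm w) ^+ 2 <= (2 / c * r) ^+ 2.
  rewrite dist ler_pdivrMr ?mulr_gt0 //.
  have cc : c ^+ 2 <= sqnorm u * sqnorm w by rewrite expr2 ler_pM // ltW.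
  apply: (@le_trans _ _ ((2 / c * r) ^+ 2 * c ^+ 2)); last first.
    by rewrite ler_wpM2l // sqr_ge0.
  have -> : (2 / c * r) ^+ 2 * c ^+ 2 = 4 * r ^+ 2 by field; rewrite gt_eqF.
  have := sqr_ge0 r; lra.
have abs_le (x : R) : x ^+ 2 <= (2 / c * r) ^+ 2 -> `|x| <= 2 / c * r.
  by rewrite -[x ^+ 2]real_normK ?num_real // ler_sqr ?nnegrE.
have e1 := sqr_ge0 (u.1 / sqnorm u - w.1 / sqnorm w).
have e2 := sqr_ge0 (u.2 / sqnorm u - w.2 / sqnorm w).
by split; rewrite /inversion /= opprD addrACA subrr add0r; apply: abs_le; lra.
Qed.

Lemma inversionK (R : realType) (z x : R * R) : x != z ->
  inversion z (inversion 0 (x - z)) = x.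
Proof.
move=> xz.
have n0 : (x.1 - z.1) ^+ 2 + (x.2 - z.2) ^+ 2 != 0.
  apply: contra xz; rewrite paddr_eq0 ?sqr_ge0 // !sqrf_eq0 !subr_eq0.
  by case: x z => [x1 x2] [z1 z2] /= /andP[/eqP-> /eqP->].
rewrite /inversion /sqnorm /= !add0r.
by case: x xz n0 => [x1 x2] _ /= n0; congr (_, _); field.
Qed.

(** The circle has [z] on it and its diameter from [z] is perpendicular to the line of
    slope [a] and intercept [b]: it is the image of that line under the inversion
    centred at [z]. *)
Lemma line_inversion_circle (R : realType) (z x : R * R) (a b : R) : 0 < b ->
  x != z ->
  circle (z.1 - a / (2 * b), z.2 + 1 / (2 * b)) (Num.sqrt (a ^+ 2 + 1) / (2 * b)) x <->
  (inversion 0 (x - z)).2 = a * (inversion 0 (x - z)).1 + b.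
Proof.
move=> b0 xz.
have n0 : 0 < (x.1 - z.1) ^+ 2 + (x.2 - z.2) ^+ 2.
  rewrite lt_neqAle addr_ge0 ?sqr_ge0 // andbT eq_sym.
  apply: contra xz; rewrite paddr_eq0 ?sqr_ge0 // !sqrf_eq0 !subr_eq0.
  by case: x z => [x1 x2] [z1 z2] /= /andP[/eqP-> /eqP->].
have s0 : 0 <= Num.sqrt (a ^+ 2 + 1) / (2 * b).
  by rewrite divr_ge0 ?sqrtr_ge0 // mulr_ge0 // ltW.
rewrite /circle /enorm /inversion /sqnorm /= !add0r.
set X := x.1 - z.1 in n0 *; set Y := x.2 - z.2 in n0 *.
have -> : x.1 - (z.1 - a / (2 * b)) = X + a / (2 * b) by rewrite /X; ring.
have -> : x.2 - (z.2 + 1 / (2 * b)) = Y - 1 / (2 * b) by rewrite /Y; ring.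
have sq : (Num.sqrt (a ^+ 2 + 1) / (2 * b)) ^+ 2 = (a ^+ 2 + 1) / (2 * b) ^+ 2.
  by rewrite expr_div_n sqr_sqrtr // addr_ge0 ?sqr_ge0.
have key : (X + a / (2 * b)) ^+ 2 + (Y - 1 / (2 * b)) ^+ 2 - (a ^+ 2 + 1) / (2 * b) ^+ 2
   = (X ^+ 2 + Y ^+ 2) / b * (a * (X / (X ^+ 2 + Y ^+ 2)) + b - Y / (X ^+ 2 + Y ^+ 2)).
  by field; rewrite !gt_eqF.
have k0 : (X ^+ 2 + Y ^+ 2) / b != 0 by rewrite gt_eqF // divr_gt0.
split=> [h|h].
  have h2 : (X + a / (2 * b)) ^+ 2 + (Y - 1 / (2 * b)) ^+ 2 = (a ^+ 2 + 1) / (2 * b) ^+ 2.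
    by rewrite -sq -h sqr_sqrtr // addr_ge0 ?sqr_ge0.
  move: key; rewrite h2 subrr => /esym/eqP; rewrite mulf_eq0 (negbTE k0) /=.
  by rewrite subr_eq0 => /eqP.
move: key; rewrite h subrr mulr0 => /eqP; rewrite subr_eq0 => /eqP ->.
by rewrite -sq sqrtr_sqr ger0_norm.
Qed.

(** Lines of slope about -1 through points of the slab keep away from the origin,
    where inversion is Lipschitz. *)
Lemma segments_inversion_null (R : realType) (m : R * R -> R) (z : R * R)
    (a b al be : R) : (forall p, `|m p + 1| <= 1 / 2) ->
  (forall c, 0 < c -> content_le (segments (slab a b) al be m) c) ->
  lebesgue_null (inversion z @` segments (slab a b) al be m).
Proof.
move=> mb E0; apply: content0_null => c c0.
pose k : R := 1 / 100; have k0 : 0 < k by rewrite /k; lra.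
have far u : segments (slab a b) al be m u -> k <= sqnorm u.
  move=> [p [p1 p2 _] [_ ue]]; have := mb p; rewrite ler_norml => mp.
  pose b0 := p.2 - m p * p.1.
  have b05 : 1 / 5 <= b0 by rewrite /b0; nra.
  have ub : u.2 - m p * u.1 = b0 by rewrite ue /line /b0; ring.
  have m2 : m p ^+ 2 <= 9 / 4 by nra.
  have b2 : 1 / 25 <= b0 ^+ 2 by nra.
  (* Cauchy-Schwarz for the vectors [u] and [(- m p, 1)]. *)
  have cs : b0 ^+ 2 <= sqnorm u * (1 + m p ^+ 2).
    rewrite -ub -subr_ge0.
    have -> : sqnorm u * (1 + m p ^+ 2) - (u.2 - m p * u.1) ^+ 2
      = (u.1 + m p * u.2) ^+ 2 by rewrite /sqnorm; ring.
    exact: sqr_ge0.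
  have s0 : 0 <= sqnorm u by rewrite /sqnorm addr_ge0 ?sqr_ge0.
  rewrite /k; nra.
have K0 : 0 <= 2 / k by rewrite divr_ge0 // ltW.
have C0 : 0 < 4 * (2 / k) ^+ 2 by rewrite mulr_gt0 // exprn_gt0 // divr_gt0.
have -> : c = 4 * (2 / k) ^+ 2 * (c / (4 * (2 / k) ^+ 2)).
  by rewrite mulrC divfK // gt_eqF.
apply: content_le_lipschitz => //; last by apply: E0; rewrite divr_gt0.
by move=> u w r /far cu /far cw; exact: inversion_lipschitz.
Qed.

Theorem corollary1p11 (R : realType) :
  exists A : set (R * R),
    lebesgue_null A /\
    forall x : R * R, exists C : set (R * R),
      [/\ is_circle C, C x & is_subset1 (C `\` A)].
Proof.
have [m mb mN] := nikodym R.
pose ctr (i : int * int) : R * R := (i.1%:~R, i.2%:~R).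
pose sep (j : rat * rat * rat * rat) :=
  let: (a, b, al, be) := j in (be < a) || (b < al).
pose E (j : rat * rat * rat * rat) : set (R * R) :=
  let: (a, b, al, be) := j in
  segments (slab (ratr a) (ratr b)) (ratr al) (ratr be) m.
pose A (i : (int * int) * (rat * rat * rat * rat)) : set (R * R) :=
  [set ctr i.1] `|` (if sep i.2 then inversion (ctr i.1) @` E i.2 else set0).
exists (\bigcup_i A i); split.
  apply: null_bigcup => -[i [[[a b] al] be]]; rewrite /A.
  apply: negligibleU.
    apply: content0_null => c c0.
    by apply: content_leS (content_le_set1 (ctr i)) => //; exact: ltW.
  rewrite /sep /E /=; have [s|_] := boolP (_ || _); last exact: negligible_set0.
  apply: segments_inversion_null => //; exact: mN.
move=> x.
(* Chosen so that [x - z] lies in [0,1] x [1,2]. *)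
pose i := (Num.floor x.1, Num.floor x.2 - 1).
pose z := ctr i.
have [/andP[x1l x1r] /andP[x2l x2r]] := (floor_itv x.1, floor_itv x.2).
rewrite !intrD !mulr1z in x1r x2r.
have z1 : z.1 = (Num.floor x.1)%:~R by [].
have z2 : z.2 = (Num.floor x.2)%:~R - 1 by rewrite /z /= intrD.
have X01 : 0 <= x.1 - z.1 <= 1 by rewrite z1; lra.
have Y12 : 1 <= x.2 - z.2 <= 2 by rewrite z2; lra.
have xz : x != z by apply/eqP => xz; move: Y12; rewrite xz; lra.
pose p := inversion 0 (x - z).
have n0 : 0 < (x.1 - z.1) ^+ 2 + (x.2 - z.2) ^+ 2 by nra.
have p1 : 0 <= p.1 <= 1.
  rewrite /p /inversion /sqnorm /= add0r; apply/andP; split.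
    by rewrite divr_ge0 ?(ltW n0) //; lra.
  rewrite ler_pdivrMr //; nra.
have p2 : 1 / 5 <= p.2 <= 1.
  rewrite /p /inversion /sqnorm /= add0r; apply/andP; split.
    rewrite ler_pdivlMr //; nra.
  rewrite ler_pdivrMr //; nra.
have mp : -3 / 2 <= m p <= -1 / 2 by have := mb p; rewrite ler_norml; lra.
pose b := p.2 - m p * p.1.
have b0 : 0 < b by rewrite /b; nra.
exists (circle (z.1 - m p / (2 * b), z.2 + 1 / (2 * b))
  (Num.sqrt (m p ^+ 2 + 1) / (2 * b))); split.
- do 2 eexists; split; last reflexivity.
  by rewrite divr_gt0 ?mulr_gt0 // sqrtr_gt0; have := sqr_ge0 (m p); lra.
- by apply/line_inversion_circle => //; rewrite -/p /b; ring.
suff only u : (circle (z.1 - m p / (2 * b), z.2 + 1 / (2 * b))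
    (Num.sqrt (m p ^+ 2 + 1) / (2 * b)) `\` \bigcup_i A i) u -> u = x.
  by move=> u w /only-> /only->.
move=> [Cu nAu].
have uz : u != z.
  apply/eqP => uz; apply: nAu; exists (i, (0, 0, 0, 0)) => //.
  by left; rewrite uz.
move/(line_inversion_circle _ b0 uz): Cu.
have uq := inversionK uz; move: uq; set q := inversion 0 (u - z) => uq qline.
have [qp|qp] := eqVneq q.1 p.1.
  rewrite -uq; have -> : q = p.
    rewrite (surjective_pairing q) (surjective_pairing p) qline qp.
    by congr (_, _); rewrite /b; ring.
  exact: inversionK.
exfalso; apply: nAu.
have line_q : q.2 = line p (m p) q.1 by rewrite qline /line /b; ring.
have [a [b' [al [be [s pab qab]]]]] : exists a b' al be : rat,
  [/\ (be < a) || (b' < al), (ratr a : R) <= p.1 <= ratr b' &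
     (ratr al : R) <= q.1 < ratr be].
  exact: separating_windows.
exists (i, (a, b', al, be)) => //; right => /=.
rewrite s; exists q => //=.
by exists p.
Qed.
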